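(* Let $G$ be an Abelian group (written additively). Define $G_2=\{g\in G \mid 2g=0\}$ and $2G=\{2g \mid g\in G\}$. Then the following conditions are equivalent: (1) $G\rightarrow(n)_r^{\cdot+\cdot}$ for all finite $n,r$; (2) $G/G_2$ is infinite; (3) $2G$ is infinite.
   Context: For a commutative (additively written) semigroup $G$ and cardinal numbers $\kappa,\theta$, the symbol $G\rightarrow(\kappa)_\theta^{\cdot+\cdot}$ denotes the statement: for every colouring (i.e. function) $c:G\longrightarrow\theta$ there exists a subset $X\subseteq G$ with $|X|=\kappa$ such that $X+X$ is monochromatic (i.e. $c$ is constant on $X+X$), where $X+X=\{x+y \mid x,y\in X\}$; here $x=y$ is allowed, so $X+X$ contains all elements $2x$ with $x\in X$. *)

(* Defs.v *)
From HB Require Import structures.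
From mathcomp Require Import all_boot all_algebra.
From mathcomp Require Import boolp classical_sets functions cardinality.

Set Implicit Arguments.
Unset Strict Implicit.
Unset Printing Implicit Defensive.

Import GRing.Theory.

Local Open Scope classical_set_scope.
Local Open Scope card_scope.
Local Open Scope ring_scope.

Definition sumset (G : addSemigroupType) (X : set G) : set G :=
  [set x + y | x in X & y in X].

Definition monochromatic (T C : Type) (c : T -> C) (A : set T) : Prop :=
  forall a b, A a -> A b -> c a = c b.

(* G -> (kappa)_theta^{.+.}. A cardinal is represented by any type having that
   cardinality. addSemigroupType is commutative by definition. *)
Definition sum_arrow (G : addSemigroupType) (kappa theta : Type) : Prop :=
  forall c : G -> theta, exists X : set G,
    X #= [set: kappa] /\ monochromatic c (sumset X).

(* The subgroup G_2. Since g = 0 is decided by the boolean equality of G, this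
   is a predicate, as required to form the group Quotient.quot (two_torsion G). *)
Definition two_torsion (G : zmodType) : {pred G} := [pred g | g *+ 2 == 0].
Arguments two_torsion : clear implicits.

Lemma two_torsion_closed (G : zmodType) : zmod_closed (two_torsion G).
Proof.
split=> [|x y]; rewrite !inE ?mul0rn // => /eqP x0 /eqP y0.
by rewrite mulrnBl x0 y0 subrr.
Qed.

HB.instance Definition _ (G : zmodType) :=
  GRing.isZmodClosed.Build G (two_torsion G) (@two_torsion_closed G).

Definition doubles (G : zmodType) : set G := [set g *+ 2 | g in [set: G]].
Arguments doubles : clear implicits.

(* Main.v *)
(* If 2G is finite, colour each element of 2G by itself and everything else by
   one extra colour. If X + X is monochromatic, then x + y = 2x for all x, y in X,
   hence X has at most one element.

   If 2G is infinite, choose h_0, h_1, ... in 2G such that distinct finite index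
   sets have distinct sums, and write h_j = 2 e_j. An infinite-dimensional van der
   Waerden theorem, proved by colour focusing, applied to z |-> c (2 z) and the
   n^2 sequences f_(k,l) t = e_(tn+k) + e_(tn+l), gives a in G and a nonempty
   finite set s such that c (2 (a + \sum_(t in s) f_(k,l) t)) does not depend on
   (k, l). The elements x_k = a + \sum_(t in s) h_(tn+k) are distinct, and
   x_k + x_l = 2 (a + \sum_(t in s) f_(k,l) t). *)

Require Import Defs.
From HB Require Import structures.
From mathcomp Require Import all_boot all_algebra.
From mathcomp Require Import boolp classical_sets functions cardinality.

Set Implicit Arguments.
Unset Strict Implicit.
Unset Printing Implicit Defensive.

Import GRing.Theory.

Local Open Scope ring_scope.

(** * An infinite-dimensional van der Waerden theorem, by colour focusing *)

Definition block (N : nat) (s : seq nat) : bool :=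
  [&& s != [::], uniq s & all (leq N) s].

Section IPvanderWaerden.
Variable G : zmodType.
Implicit Types (f : nat -> nat -> G) (N k : nat).

Local Notation "f `[ s ]" := (\sum_(t <- s) f t) (at level 8, format "f `[ s ]").

(* The list L is chosen before the colouring: this is what allows the focusing
   step to recolour z by the colours c (z + t), with t in a fixed finite list. *)
Definition ip_vdw k : Prop :=
  forall f (C : finType) N, exists L : seq (G * seq nat),
    (forall p, p \in L -> block N p.2) /\
    forall c : G -> C, exists2 p, p \in L &
      forall i, (i < k)%N -> c (p.1 + (f i)`[p.2]) = c (p.1 + (f 0%N)`[p.2]).

(** The point [p.1] is the focus, and each index set in [p.2] yields one spoke; different spokes may
    have different colours. *)
Definition focused k f (C : finType) (c : G -> C) (p : G * seq (seq nat)) :=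
  forall s i, s \in p.2 -> (i < k)%N ->
    c (p.1 + (f i)`[s]) = c (p.1 + (f 0%N)`[s]).

Lemma block_cat N M s u :
  block N s -> block M u -> (N <= M)%N -> {in s, forall t, t < M}%N ->
  block N (s ++ u).
Proof.
case/and3P=> s0 us Ns /and3P[u0 uu Mu] NM sM; apply/and3P; split.
- by case: (s) s0.
- rewrite cat_uniq us uu andbT; apply/hasPn => t /(allP Mu) Mt.
  by apply/negP => /sM; rewrite ltnNge Mt.
- rewrite all_cat Ns; apply/allP => t /(allP Mu); exact: leq_trans.
Qed.

(** Induction on the number [m] of differently coloured spokes. A further use of [ip_vdw], beyond
    all indices used so far, yields equally coloured copies of a configuration, and the colour of
    the old focus becomes that of an additional spoke. *)
Lemma color_focusing k f (C : finType) N m : ip_vdw k ->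
  exists L : seq (G * seq (seq nat)),
    (forall p s, p \in L -> s \in p.2 -> block N s) /\
    forall c : G -> C, exists2 p, p \in L & focused k f c p /\
      ((exists2 s, s \in p.2 & c p.1 = c (p.1 + (f 0%N)`[s])) \/
       size p.2 = m /\
       uniq (c p.1 :: [seq c (p.1 + (f 0%N)`[s]) | s <- p.2])).
Proof.
move=> vdw; elim: m => [|m [L [LN Lc]]].
  exists [:: (0, [::])]; split=> [p s|c]; first by rewrite inE => /eqP->.
  by exists (0, [::]); rewrite ?inE //; split=> //; right.
(* All foci and spoke points of [L]: the finitely many shifts at which colours are compared. *)
pose T := flatten [seq p.1 :: [seq p.1 + (f i)`[s] | i <- iota 0 k.+1, s <- p.2]
                  | p <- L].
have T1 p : p \in L -> p.1 \in T.
  by move=> pL; apply/flatten_mapP; exists p; rewrite ?inE ?eqxx.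
have T2 p s i : p \in L -> s \in p.2 -> (i < k.+1)%N ->
    p.1 + (f i)`[s] \in T.
  move=> pL sp ik; apply/flatten_mapP; exists p; rewrite ?inE //.
  by apply/orP; right; apply/allpairsP; exists (i, s); rewrite mem_iota.
(* [M] exceeds every index occurring in [L], so an index set taken from [M] on is disjoint from the
   earlier ones. *)
pose M := (N + \sum_(t <- flatten (flatten [seq p.2 | p <- L])) t).+1.
have NM : (N <= M)%N by rewrite /M leqW ?leq_addr.
have sM p s : p \in L -> s \in p.2 -> {in s, forall t, t < M}%N.
  move=> pL sp t ts; rewrite /M ltnS.
  have tF : t \in flatten (flatten [seq p.2 | p <- L]).
    apply/flattenP; exists s => //; apply/flattenP; exists p.2 => //.
    exact: map_f.
  by rewrite (big_rem t) //= addnCA leq_addr.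
have [U [UM Uc]] := vdw f {ffun 'I_(size T) -> C} M.
(* The first family translates old configurations, for the case that a spoke already matches its
   focus. The second adjoins the new index set to each old spoke and takes it alone as the extra
   spoke. *)
exists ([seq (q.1 + (f 0%N)`[q.2] + p.1, p.2) | q <- U, p <- L] ++
        [seq (q.1 + p.1, q.2 :: [seq s ++ q.2 | s <- p.2]) | q <- U, p <- L]).
split=> [p s|c].
  rewrite mem_cat => /orP[] /allpairsP[[q p'] /= [qU pL ->]] /=; first exact: LN.
  rewrite inE => /predU1P[->|/mapP[s' sp ->]].
    have /and3P[q0 uq Mq] := UM _ qU; apply/and3P; split=> //.
    by apply/allP => t /(allP Mq); apply: leq_trans.
  exact: (block_cat (LN _ _ pL sp) (UM _ qU) NM (sM _ _ pL sp)).
(* Colouring [z] by the vector of colours of its translates by [T] makes the copies of [T] based at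
   the [k] points of the new spoke agree colour by colour. *)
have [[a S] qU qc] := Uc (fun z => [ffun i => c (z + tnth (in_tuple T) i)]).
have {}qc i t : (i < k)%N -> t \in T ->
    c (a + (f i)`[S] + t) = c (a + (f 0%N)`[S] + t).
  move=> ik /seq_tnthP[j ->]; have /ffunP/(_ j) := qc i ik.
  by rewrite !ffunE.
have [[e ss] pL [foc alt]] := Lc (fun z => c (a + (f 0%N)`[S] + z)).
have memL1 : (a + (f 0%N)`[S] + e, ss) \in
    [seq (q.1 + (f 0%N)`[q.2] + p.1, p.2) | q <- U, p <- L].
  by apply/allpairsP; exists ((a, S), (e, ss)).
case: alt => [[s sp /= cs]|[/= szss uss]].
  exists (a + (f 0%N)`[S] + e, ss); first by rewrite mem_cat memL1.
  split=> [s' i /= s'p ik|]; first by rewrite -!addrA addrA foc // !addrA.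
  by left; exists s => //=; rewrite cs !addrA.
pose ss' := S :: [seq s ++ S | s <- ss].
have shift i s : a + e + (f i)`[s ++ S] = a + (f i)`[S] + (e + (f i)`[s]).
  by rewrite big_cat /= [_ + (f i)`[S]]addrC addrACA.
(* The new spokes inherit the colours of the old focus and the old spokes, which are pairwise
   distinct here. *)
have col0 : [seq c (a + e + (f 0%N)`[s]) | s <- ss'] =
    c (a + (f 0%N)`[S] + e) ::
    [seq c (a + (f 0%N)`[S] + (e + (f 0%N)`[s])) | s <- ss].
  rewrite /= addrAC -map_comp; congr (_ :: _); apply: eq_map => s /=.
  by rewrite shift.
exists (a + e, ss').
  rewrite mem_cat; apply/orP; right.
  by apply/allpairsP; exists ((a, S), (e, ss)).
split=> [s i /=|].
  rewrite inE => /predU1P[-> ik|/mapP[s' sp -> ik]].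
    by rewrite ![a + e + _]addrAC qc // (T1 _ pL).
  rewrite !shift (qc _ (e + _)) //; first exact: foc.
  by apply: (T2 (e, ss)) => //; apply: ltnW.
have [/mapP[s sp cs]|ncs] :=
    boolP (c (a + e) \in [seq c (a + e + (f 0%N)`[s]) | s <- ss']).
  by left; exists s.
right; split; first by rewrite /= size_map szss.
by move: uss; rewrite -cons_uniq -col0.
Qed.

(** Induction on [k]: once [f k] is subtracted from every sequence, the point belonging to [f k] is
    the focus itself, so a spoke in the colour of its focus settles [k.+1] sequences. *)
Lemma ip_van_der_Waerden k : ip_vdw k.
Proof.
elim: k => [|k IHk] f C N.
  exists [:: (0, [:: N])]; split=> [p|c]; last by exists (0, [:: N]); rewrite ?inE.
  by rewrite inE => /eqP->; rewrite /block /= leqnn.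
pose g i t := f i t - f k t.
have gE i s : (g i)`[s] = (f i)`[s] - (f k)`[s] by rewrite sumrB.
have [L [LN Lc]] := color_focusing g C N #|C| IHk.
exists [seq (p.1 - (f k)`[s], s) | p <- L, s <- p.2]; split=> [q|c].
  by case/allpairsPdep=> p [s [pL sp ->]]; apply: LN pL sp.
have [p pL [foc [[s sp cs]|[szp /card_uniqP]]]] := Lc c; last first.
  (* Otherwise [#|C|] spokes and their focus would show [#|C|.+1] distinct colours. *)
  move=> /= cardp; have := max_card (mem (c p.1 ::
    [seq c (p.1 + (g 0%N)`[s]) | s <- p.2])).
  by rewrite cardp size_map szp ltnn.
exists (p.1 - (f k)`[s], s).
  by apply/allpairsPdep; exists p, s.
have pE i : p.1 - (f k)`[s] + (f i)`[s] = p.1 + (g i)`[s].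
  by rewrite gE addrAC addrA.
move=> i; rewrite /= ltnS leq_eqVlt => /predU1P[->|ik]; rewrite !pE -?cs.
  by rewrite gE subrr addr0.
by rewrite foc.
Qed.

End IPvanderWaerden.

(** * Sequences whose finite subset sums are distinct *)

Section Dissociated.
Variable G : zmodType.

Lemma infinite_set_avoid (A : set G) (F : seq G -> seq G) : infinite_set A ->
  exists e : nat -> G, forall n, A (e n) /\ e n \notin F (mkseq e n).
Proof.
move=> Ainf.
have /choice[pick pickP] l : exists x, A x /\ x \notin F l.
  have /infinite_setN0[x [Ax /= Fx]] := infinite_setD Ainf (finite_seq (F l)).
  by exists x; split=> //; apply/negP.
(* Recursion on the list of all earlier terms, since each choice depends on the whole history. *)
pose pre := fix pre n := if n is n'.+1 then rcons (pre n') (pick (pre n')) else [::].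
exists (pick \o pre) => n.
suff -> : mkseq (pick \o pre) n = pre n by apply: pickP.
by elim: n => // n IHn; rewrite mkseqS IHn.
Qed.

(** Each term avoids the finitely many differences of two subset sums of earlier terms. If different
    index sets had equal sums, the term at the largest index where they differ would be such a
    difference. *)
Lemma dissociated_sequence (A : set G) : infinite_set A ->
  exists2 e : nat -> G, forall n, A (e n) &
    forall p q : seq nat, uniq p -> uniq q ->
      \sum_(j <- p) e j = \sum_(j <- q) e j -> p =i q.
Proof.
pose F (l : seq G) :=
  [seq \sum_(j in B) l`_j - \sum_(j in D) l`_j
  | B : {set 'I_(size l)} <- enum {: {set 'I_(size l)}},
    D : {set 'I_(size l)} <- enum {: {set 'I_(size l)}}].
move=> /(infinite_set_avoid F)[e eP]; exists e => [n|]; first by case: (eP n).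
have eNF n (P Q : pred nat) :
    e n <> \sum_(j < n | P j) e j - \sum_(j < n | Q j) e j.
  move=> en; have [_ /negP[]] := eP n; rewrite {1}en.
  have: forall j, (j < n)%N -> (mkseq e n)`_j = e j by apply: nth_mkseq.
  (* [F] uses subsets of ['I_(size l)], so [n] is replaced by [size l] to make the types match. *)
  move: (size_mkseq e n); move: (mkseq e n) => l; case: n / {en} => nthE.
  apply/allpairsP; exists ([set j | P (val j)], [set j | Q (val j)])%SET.
  rewrite !mem_enum; split=> //=.
  by congr (_ - _); apply: eq_big => j; rewrite ?inE // => _; rewrite nthE.
have sumS n (P : pred nat) : \sum_(j < n.+1 | P j) e j =
    \sum_(j < n | P j) e j + (if P n then e n else 0).
  by rewrite big_mkcond big_ord_recr /= -big_mkcond.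
have sumP n (P Q : pred nat) : \sum_(j < n | P j) e j = \sum_(j < n | Q j) e j ->
    forall j, (j < n)%N -> P j = Q j.
  elim: n => // n IHn; rewrite !sumS => sumPQ.
  have PQn : P n = Q n.
    case: (P n) (Q n) sumPQ => [] [] //; rewrite addr0 => sumPQ; exfalso.
      by apply: (eNF n Q P); rewrite -sumPQ addrAC subrr add0r.
    by apply: (eNF n P Q); rewrite sumPQ addrAC subrr add0r.
  move: sumPQ; rewrite PQn => /addIr/IHn PQ j; rewrite ltnS leq_eqVlt.
  by case/predU1P => [->|/PQ].
move=> p q up uq sumpq.
have [n [pn qn]] : exists n, (forall j, j \in p -> j < n)%N /\
    (forall j, j \in q -> j < n)%N.
  exists (\sum_(j <- p ++ q) j).+1.
  have lt j : j \in p ++ q -> (j < (\sum_(j <- p ++ q) j).+1)%N.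
    by move=> jpq; rewrite ltnS (big_rem j) //= leq_addr.
  by split=> j jp; apply: lt; rewrite mem_cat jp ?orbT.
have sumE (s : seq nat) : uniq s -> (forall j, j \in s -> j < n)%N ->
    \sum_(j <- s) e j = \sum_(j < n | (j : nat) \in s) e j.
  move=> us sn; rewrite -(big_mkord (mem s)) -big_filter; apply: perm_big.
  rewrite uniq_perm ?filter_uniq ?iota_uniq // => j.
  by rewrite mem_filter mem_index_iota /=; have [/sn->|] := boolP (j \in s).
move: sumpq; rewrite !sumE // => /sumP pq j.
have [/pq //|nj] := ltnP j n.
by apply/idP/idP => [/pn|/qn]; rewrite ltnNge nj.
Qed.

End Dissociated.

(** * The arrow relation, the doubles and the quotient by the 2-torsion *)

Section Equivalences.
Variable G : zmodType.
Local Open Scope classical_set_scope.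
Local Open Scope card_scope.

Lemma infinite_doubles_sum_arrow (n r : nat) :
  infinite_set (doubles G) -> sum_arrow G 'I_n 'I_r.
Proof.
move=> /dissociated_sequence[h h2 hdis] c.
have /choice[e eP] j : exists g, g *+ 2 = h j by have [g _ <-] := h2 j; exists g.
(* [i] encodes the pair [(i %/ n, i %% n)], and each [t] owns the [n] indices from [t * n] on. *)
pose f i t := e (t * n + i %/ n)%N + e (t * n + i %% n)%N.
have [L [LN Lc]] := @ip_van_der_Waerden G (n * n) f 'I_r 0.
have [[a s] pL /= fc] := Lc (fun z => c (z *+ 2)).
have /and3P[/= s0 us _] := LN _ pL.
pose x (k : 'I_n) := a + \sum_(t <- s) h (t * n + k)%N.
have code_lt (k l : 'I_n) : (k * n + l < n * n)%N.
  apply: leq_trans (_ : k.+1 * n <= _)%N; last by rewrite leq_mul2r ltn_ord orbT.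
  by rewrite mulSn addnC ltn_add2r.
have xD k l : x k + x l = (a + \sum_(t <- s) f (k * n + l)%N t) *+ 2.
  have n0 : (0 < n)%N by apply: leq_trans (ltn_ord k).
  rewrite mulrnDl -sumrMnl /x addrACA -mulr2n -big_split /=; congr (_ + _).
  apply: eq_bigr => t _; rewrite /f divnMDl // divn_small // addn0.
  by rewrite modnMDl modn_small // mulrnDl !eP.
(* Equal sums force equal index sets; these are nonempty, and the residue modulo [n] of any member
   recovers [k]. *)
have x_inj : injective x.
  move=> k l /addrI sumE; apply/val_inj => /=.
  have n0 : (0 < n)%N by apply: leq_trans (ltn_ord k).
  have umap (m : nat) : uniq [seq (t * n + m)%N | t <- s].
    by rewrite map_inj_uniq // => t u /addIn/eqP; rewrite eqn_pmul2r // => /eqP.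
  have := hdis _ _ (umap k) (umap l); rewrite !big_map => /(_ sumE) kl.
  have [t ts] : exists t, t \in s.
    by case: (s) s0 => // t s' _; exists t; apply: mem_head.
  have : (t * n + k)%N \in [seq (t * n + k)%N | t <- s].
    by apply/mapP; exists t.
  rewrite kl => /mapP[u _] /(congr1 (modn^~ n)).
  by rewrite !modnMDl !modn_small.
exists (range x); split.
  by apply: inj_card_eq => k l _ _; apply: x_inj.
move=> _ _ [_ [k _ <-] [_ [l _ <-] <-]] [_ [k' _ <-] [_ [l' _ <-] <-]].
by rewrite !xD !fc.
Qed.

Lemma sum_arrow_infinite_doubles :
  (forall n r : nat, sum_arrow G 'I_n 'I_r) -> infinite_set (doubles G).
Proof.
move=> arrow /finite_seqP[s sE].
have ds g : g *+ 2 \in s.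
  by have : doubles G (g *+ 2) by [exists g]; rewrite sE.
(* [index] returns [size s] outside [s]; this value is the extra colour. *)
have [X [Xcard Xc]] := arrow 2 (size s).+1 (fun g => inord (index g s)).
have X1 x y : X x -> X y -> x = y.
  move=> Xx Xy.
  have /(congr1 val) : inord (index (x + y) s) =
      inord (index (x *+ 2) s) :> 'I_(size s).+1.
    by apply: Xc; rewrite ?mulr2n; exists x => //; [exists y|exists x].
  rewrite /= !inordK ?ltnS ?index_size // => indexE.
  (* [x *+ 2] is in [s], so the common colour is not the extra one. *)
  have xys : x + y \in s by rewrite -index_mem indexE index_mem.
  apply: (@addrI _ x); move/(congr1 (nth 0 s)): indexE.
  by rewrite !nth_index // mulr2n => ->.
have /card_bijP[f [_ /can_inj f_inj _]] : [set: 'I_2] #= X by rewrite card_eq_sym.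
have : to_setT ord0 = to_setT ord_max :> [set: 'I_2].
  by apply/f_inj/val_inj/X1; apply: set_valP.
by move/(congr1 set_val).
Qed.

(** Doubling has kernel [two_torsion G], so it induces a bijection from the quotient onto
    [doubles G]. *)
Lemma infinite_quotient_doubles :
  infinite_set [set: Quotient.quot (two_torsion G)] <-> infinite_set (doubles G).
Proof.
pose d (q : Quotient.quot (two_torsion G)) : G := repr q *+ 2.
have d_inj : injective d.
  move=> q q' dq; rewrite -[q]reprK -[q']reprK; apply/eqP.
  by rewrite -(Quotient.idealrBE (two_torsion G)) inE mulrnBl subr_eq0; apply/eqP.
suff dE : doubles G = range d.
  have /eq_finite_set : range d #= [set: Quotient.quot (two_torsion G)].
    by apply: inj_card_eq => q q' _ _; apply: d_inj.
  by rewrite dE => ->.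
rewrite eqEsubset; split=> [_ [g _ <-]|_ [q _ <-]]; last by exists (repr q).
(* The representative of the class of [g] may differ from [g], but only by an element that doubling
   kills. *)
exists (\pi g)%qT => //; apply/eqP.
rewrite /d -subr_eq0 -mulrnBl.
have : repr (\pi_(Quotient.quot (two_torsion G)) g)%qT - g \in two_torsion G.
  by rewrite (Quotient.idealrBE (two_torsion G)) reprK.
by rewrite inE.
Qed.

End Equivalences.

Theorem theorem1 (G : zmodType) :
  ((forall n r : nat, sum_arrow G 'I_n 'I_r) <->
     infinite_set [set: Quotient.quot (two_torsion G)]%classic) /\
  (infinite_set [set: Quotient.quot (two_torsion G)]%classic <->
     infinite_set (doubles G)).
Proof.
split; last exact: infinite_quotient_doubles.
rewrite infinite_quotient_doubles; split; first exact: sum_arrow_infinite_doubles.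
by move=> G2inf n r; apply: infinite_doubles_sum_arrow.
Qed.
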